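(* Let $U_1$ and $U_2$ be two timed automaton templates with conjunctive guards, let $Q\in\{E,E_{\mathit{inf}},E_{\mathit{fin}}\}$, and let $\Phi(1_l)$, $l\in\{1,2\}$, be an IMTL path formula whose atomic propositions refer only to instance $1$ of template $U_l$. Then for every $n\in\mathbb{N}$ with $n\ge1$: (i) $(U_1,U_2)^{(1,n)}\models Q\Phi(1_2)\Rightarrow(U_1,U_2)^{(1,n+1)}\models Q\Phi(1_2)$; (ii) $(U_1,U_2)^{(1,n)}\models Q\Phi(1_1)\Rightarrow(U_1,U_2)^{(1,n+1)}\models Q\Phi(1_1)$.
   Context: Temporal constraints: for a finite set $C$ of clocks, $TC(C)$ is generated by $\top$, $\neg$, $\vee$, $x\sim y$ and $x\sim q$ with $x,y\in C$, $q\in\mathbb{Q}^{\geq0}$, $\sim\in\{<,\le,>,\ge,=\}$. A timed automaton (TA) template is $U_l=\langle S_l,\hat s_l,C_l,\Gamma_l,\tau_l,I_l\rangle$ with finite state set $S_l$, initial state $\hat s_l$, finite clock set $C_l$, finite set $\Gamma_l$ of Boolean guards over states, transitions $\tau_l\subseteq S_l\times TC(C_l)\times 2^{C_l}\times\Gamma_l\times S_l$, and invariants $I_l:S_l\to TC(C_l)$ with $I_l(\hat s_l)=\top$. For natural numbers $n_1,n_2$, the network $(U_1,U_2)^{(n_1,n_2)}$ is the asynchronous parallel composition of instances $U_l^i$ ($i\in[1,n_l]$), each a disjoint copy of $U_l$. Conjunctive guards: every guard of a transition of instance $U_l^i$ is a conjunction, over every other instance $U_h^j$, of a disjunction $\hat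 s_h(j)\vee s^1(j)\vee\dots\vee s^q(j)$ of propositions ''instance $U_h^j$ is in state $s$'', where the initial state $\hat s_h(j)$ always appears. A configuration gives each instance a state and a clock valuation into $\mathbb{R}^{\ge0}$ satisfying the state's invariant; the initial configuration has all instances in initial states with clocks $0$. Transitions: a delay by $d\in\mathbb{R}^{\ge0}$ keeps states, increases all clocks by $d$, invariants holding throughout; a discrete step lets a single instance in state $s$ take $(s,g,r,\gamma,t)$ if its clocks satisfy $g$ and the global state vector satisfies $\gamma$, moving to $t$ and resetting clocks in $r$, provided the new invariant holds; other instances unchanged. A timed computation is a finite or infinite sequence $(\mathfrak c_0,t_0)(\mathfrak c_1,t_1)\dots$ from the initial configuration with $t_0=0$, each step a delay $d>0$ ($t_{v+1}=t_v+d$) or a discrete step ($t_{v+1}=t_v$); it is infinite, deadlocked (maximal finite, ending where all discrete transitions are disabled), or finite. It induces an s-path $\rho(t)=(\text{states of }\mathfrak c_v,\text{clocks of }\mathfrak c_v+(t-t_v))$ on $[t_v,t_{v+1})$. Atomic propositions $p(l,i)$, $p\in S_l$, hold iff $U_l^i$ is in state $p$. An IMTL path formula is built from atomic propositions with $\wedge$, $\neg$ and $\Phi_1\mathcal{U}_{\sim q}\Phi_2$ ($q\in\mathbb{Q}^{\ge0}$), where $\rho\models\Phi_1\mathcal{U}_{\sim q}\Phi_2$ iff for some $t'\sim q$ the suffix from $t'$ satisfies $\Phi_2$ and the suffix from every $t\in[0,t')$ satisfies $\Phi_1$; an atomic proposition holds on a path iff it holds at time $0$. $E\Phi$ (resp.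 $E_{\mathit{inf}}\Phi$, $E_{\mathit{fin}}\Phi$) holds iff some s-path from the initial configuration that is infinite or deadlocked (resp. infinite, resp. finite) satisfies $\Phi$. *)

(* Defs.v *)
From HB Require Import structures.
From mathcomp Require Import all_boot all_order all_algebra.
From mathcomp Require Import interval_inference reals.

Set Implicit Arguments.
Unset Strict Implicit.
Unset Printing Implicit Defensive.
Import Order.TTheory GRing.Theory Num.Theory.
Local Open Scope ring_scope.

Inductive cmp := CLt | CLe | CGt | CGe | CEq.

Definition cmp_sem (R : realType) (o : cmp) (a b : R) : bool :=
  match o with
  | CLt => a < b
  | CLe => a <= b
  | CGt => a > b
  | CGe => a >= b
  | CEq => a == b
  end.

Inductive tc (C : finType) :=
  | TCtop
  | TCneg of tc C
  | TCor of tc C & tc C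
  | TCclk of C & cmp & C
  | TCcst of C & cmp & {nonneg rat}.
Arguments TCtop {C}.

Fixpoint tc_sat (R : realType) (C : finType) (v : C -> R) (g : tc C) : bool :=
  match g with
  | TCtop => true
  | TCneg g1 => ~~ tc_sat v g1
  | TCor g1 g2 => tc_sat v g1 || tc_sat v g2
  | TCclk x o y => cmp_sem o (v x) (v y)
  | TCcst x o q => cmp_sem o (v x) (ratr q%:num)
  end.

(* The two templates are indexed by [bool]. *)
Notation T1 := false (only parsing).
Notation T2 := true (only parsing).

(* [gam : guard S] stands for the conjunction, over every other instance
   [U_h^j], of the disjunction of the propositions [s(j)] for [s \in gam h]. *)
Definition guard (S : bool -> finType) := {dffun forall h : bool, {set S h}}.

Record template (S : bool -> finType) (l : bool) := Template {
  init : S l;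
  clock : finType;
  guards : {set guard S};
  trans : S l -> tc clock -> {set clock} -> guard S -> S l -> Prop;
  locinv : S l -> tc clock;
  trans_guard : forall s g r gam t, trans s g r gam t -> gam \in guards;
  locinv_init : locinv init = TCtop
}.

Arguments trans {S l} _ _ _ _ _ _.

Definition conjunctive (S : bool -> finType) (U : forall l, template S l) :=
  forall (l : bool) s g r gam t, trans (U l) s g r gam t ->
  forall h : bool, init (U h) \in gam h.

Definition templates (S : bool -> finType) (U1 : template S T1)
    (U2 : template S T2) : forall l, template S l :=
  fun l => match l with T1 => U1 | T2 => U2 end.

(* The sizes [(n1, n2)] of a network, as a function of the template index. *)
Definition sizes (n1 n2 : nat) : bool -> nat := fun l => if l then n2 else n1.

Definition inst (N : bool -> nat) := {l : bool & 'I_(N l)}.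

Section Network.
Variables (R : realType) (S : bool -> finType) (U : forall l, template S l).
Variable N : bool -> nat.

Record state := State {
  loc : forall u : inst N, S (tag u);
  clk : forall u : inst N, clock (U (tag u)) -> R
}.

Arguments loc _ _ : clear implicits.
Arguments clk _ _ _ : clear implicits.

Definition is_config (c : state) := forall u : inst N,
  (forall x, 0 <= clk c u x) /\
  tc_sat (clk c u) (locinv (U (tag u)) (loc c u)).

Definition init_config : state :=
  State (fun u => init (U (tag u))) (fun _ _ => 0).

Definition delay (c : state) (d : R) : state :=
  State (loc c) (fun u x => clk c u x + d).

Definition delay_step (d : R) (c c' : state) :=
  [/\ 0 <= d, c' = delay c d &
      forall d', 0 <= d' <= d -> is_config (delay c d')].

Definition guard_sat (c : state) (u : inst N) (gam : guard S) :=
  forall u' : inst N, u' != u -> loc c u' \in gam (tag u').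

Definition discrete_step (c c' : state) :=
  exists (u : inst N) g (r : {set clock (U (tag u))}) gam,
    [/\ trans (U (tag u)) (loc c u) g r gam (loc c' u),
        tc_sat (clk c u) g,
        guard_sat c u gam,
        (forall x, clk c' u x = if x \in r then 0 else clk c u x) &
        (forall u', u' != u ->
           loc c' u' = loc c u' /\ clk c' u' =1 clk c u')
        /\ is_config c'].

Definition timed_step (a b : state * R) :=
  (exists2 d, 0 < d & delay_step d a.1 b.1 /\ b.2 = a.2 + d) \/
  (discrete_step a.1 b.1 /\ b.2 = a.2).

(* A finite or infinite sequence: entry [v] is meaningful when [v <= k] if
   [last_index = Some k], and for every [v] if [last_index = None]. *)
Record timed_seq := TimedSeq {
  last_index : option nat;
  entry : nat -> state * R
}.

Definition in_range (x : timed_seq) (v : nat) : bool :=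
  if last_index x is Some k then (v <= k)%N else true.

Definition timed_computation (x : timed_seq) :=
  entry x 0 = (init_config, 0) /\
  forall v, in_range x v.+1 -> timed_step (entry x v) (entry x v.+1).

Definition is_infinite (x : timed_seq) := last_index x = None.

Definition is_finite (x : timed_seq) := exists k, last_index x = Some k.

(* Maximality excludes any continuation, by a delay or by a discrete step. *)
Definition deadlocked (x : timed_seq) :=
  exists k, [/\ last_index x = Some k,
    (forall b, ~ timed_step (entry x k) b) &
    (forall c', ~ discrete_step (entry x k).1 c')].

(* A path is a partial function from time to states, given by its graph. *)
Definition tpath := R -> state -> Prop.

(* The intervals [[t_v, t_(v+1)[] are those of consecutive entries only: the
   path of a finite computation ending at time [T] has domain [[0, T[], as has
   that of an infinite computation whose times converge to [T]. *)
Definition spath (x : timed_seq) : tpath := fun t c =>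
  exists v, [/\ in_range x v.+1,
    (entry x v).2 <= t < (entry x v.+1).2 &
    c = delay (entry x v).1 (t - (entry x v).2)].

Definition from_time (rho : tpath) (t' : R) : tpath := fun t => rho (t' + t).

End Network.

Arguments loc {R S U N} _ _.
Arguments clk {R S U N} _ _ _.

(* [FAtom l i p] is the proposition [p(l, i)], instances being numbered from 1. *)
Inductive imtl (S : bool -> finType) :=
  | FAtom (l : bool) (i : nat) (p : S l)
  | FAnd of imtl S & imtl S
  | FNot of imtl S
  | FUntil of imtl S & cmp & {nonneg rat} & imtl S.

Fixpoint only_instance (S : bool -> finType) (l : bool) (i : nat)
    (Phi : imtl S) : bool :=
  match Phi with
  | FAtom l' i' _ => (l' == l) && (i' == i)
  | FAnd Phi1 Phi2 => only_instance l i Phi1 && only_instance l i Phi2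
  | FNot Phi1 => only_instance l i Phi1
  | FUntil Phi1 _ _ Phi2 => only_instance l i Phi1 && only_instance l i Phi2
  end.

(* On the empty path, which has no value at time 0, atoms are false. *)
Fixpoint sat (R : realType) (S : bool -> finType) (U : forall l, template S l)
    (N : bool -> nat) (rho : tpath R U N) (Phi : imtl S) : Prop :=
  match Phi with
  | FAtom l i p => exists2 c, rho 0 c &
      exists2 j : 'I_(N l), j.+1 = i & loc c (Tagged (fun h => 'I_(N h)) j) = p
  | FAnd Phi1 Phi2 => sat rho Phi1 /\ sat rho Phi2
  | FNot Phi1 => ~ sat rho Phi1
  | FUntil Phi1 o q Phi2 => exists t' : R,
      [/\ 0 <= t', exists c, rho t' c, cmp_sem o t' (ratr q%:num),
          sat (from_time rho t') Phi2 &
          forall t, 0 <= t < t' -> sat (from_time rho t) Phi1]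
  end.

Inductive quant := QE | QEinf | QEfin.

Definition quant_sem (R : realType) (S : bool -> finType)
    (U : forall l, template S l) (N : bool -> nat) (Q : quant)
    (x : timed_seq R U N) : Prop :=
  match Q with
  | QE => is_infinite x \/ deadlocked x
  | QEinf => is_infinite x
  | QEfin => is_finite x
  end.

Definition models (R : realType) (S : bool -> finType)
    (U : forall l, template S l) (N : bool -> nat) (Q : quant)
    (Phi : imtl S) : Prop :=
  exists x : timed_seq R U N,
    [/\ timed_computation x, quant_sem Q x & sat (spath x) Phi].

(* Main.v *)
Require Import Defs.
From HB Require Import structures.
From mathcomp Require Import all_boot all_order all_algebra.
From mathcomp Require Import interval_inference reals boolp.

Set Implicit Arguments.
Unset Strict Implicit.
Unset Printing Implicit Defensive.
Import Order.TTheory GRing.Theory Num.Theory.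
Local Open Scope ring_scope.

(* Let the additional instances idle in their initial state, whose invariant is
   trivial; since every guard tolerates initial states, the given computation
   lifts to the larger network, with the same s-path for the old instances.
   Only deadlocks need care, as an idling instance may be able to move where
   the old instances are stuck. The old instances then block both delays and
   their own discrete steps for good, whatever the additional instances do, so
   these are run alone until they are stuck too, or forever. This takes no time
   and hence does not change the s-path. *)

Section MoreInstances.
Variables (R : realType) (S : bool -> finType) (U : forall l, template S l).
Variables N N' : bool -> nat.
Hypothesis leN : forall l, (N l <= N' l)%N.

(** * Embedding of instances, restriction and idle extension of states *)

Definition widen_inst (u : inst N) : inst N' :=
  Tagged (fun l => 'I_(N' l)) (widen_ord (leN (tag u)) (tagged u)).

Lemma widen_inst_inj : injective widen_inst.
Proof.
move=> [l i] [l' j] e.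
have /= el := congr1 (fun u : inst N' => tag u) e.
(* Projecting the index to [nat] gives an equation whose type does not depend on the tag. *)
have /= eij := congr1 (fun u : inst N' => val (tagged u)) e.
by case: l' / el j e eij => j _ eij; congr existT; apply: val_inj.
Qed.

Definition restrict (C : state R U N') : state R U N :=
  @State R S U N (fun u => loc C (widen_inst u)) (fun u => clk C (widen_inst u)).

(** An instance that has idled since time 0 has never reset a clock, so all its clocks read the
    absolute time [t]. The test [insub] succeeds exactly on the indices of old instances. *)
Definition idle_ext (c : state R U N) (t : R) : state R U N' :=
  @State R S U N'
    (fun u => match u with existT l j =>
       if insub (val j) is Some i then loc c (Tagged (fun l => 'I_(N l)) i)
       else init (U l) end)
    (fun u => match u with existT l j =>
       if insub (val j) is Some i then clk c (Tagged (fun l => 'I_(N l)) i)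
       else fun=> t end).

Lemma loc_idle_ext c t u : loc (idle_ext c t) (widen_inst u) = loc c u.
Proof. by case: u => l i /=; rewrite valK. Qed.

Lemma clk_idle_ext c t u : clk (idle_ext c t) (widen_inst u) = clk c u.
Proof. by case: u => l i /=; rewrite valK. Qed.

Lemma widen_instP (u : inst N') :
  (exists w, u = widen_inst w) \/
  [/\ forall w, widen_inst w != u,
      forall c t, loc (idle_ext c t) u = init (U (tag u)) &
      forall c t, clk (idle_ext c t) u = fun=> t].
Proof.
case: u => l j; have [lt_jN|ge_jN] := ltnP j (N l).
  left; exists (Tagged (fun l => 'I_(N l)) (Ordinal lt_jN)).
  by congr existT; apply: val_inj.
right; split=> [w | c t | c t] /=; last 2 first.
- by rewrite insubN // -leqNgt.
- by rewrite insubN // -leqNgt.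
apply/eqP; case: w => l' i e.
have /= el := congr1 (fun u : inst N' => tag u) e.
have /= eij := congr1 (fun u : inst N' => val (tagged u)) e.
by have := ltn_ord i; rewrite eij el ltnNge ge_jN.
Qed.

Lemma restrict_idle_ext c t : restrict (idle_ext c t) = c.
Proof.
case: c => lc ck; rewrite /restrict; congr State;
  apply: functional_extensionality_dep => u.
- exact: loc_idle_ext.
- exact: clk_idle_ext.
Qed.

Lemma delay_idle_ext c t d :
  delay (idle_ext c t) d = idle_ext (delay c d) (t + d).
Proof.
rewrite /delay /idle_ext /=; congr State;
  apply: functional_extensionality_dep => -[l j] //=.
by apply: funext => x; case: insub.
Qed.

Lemma idle_ext_init : idle_ext (init_config R U N) 0 = init_config R U N'.
Proof.
rewrite /init_config /idle_ext; congr State;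
  apply: functional_extensionality_dep => -[l j] /=; by case: insub.
Qed.

(** * Transfer of configurations and steps in both directions *)

Lemma idle_ext_config c t : 0 <= t -> is_config c -> is_config (idle_ext c t).
Proof.
move=> t_ge0 c_ok u; case: (widen_instP u) => [[w ->]|[_ -> ->]].
  by rewrite loc_idle_ext clk_idle_ext; apply: c_ok.
by split=> // ; rewrite locinv_init.
Qed.

Lemma restrict_config C : is_config C -> is_config (restrict C).
Proof. by move=> C_ok u; apply: C_ok (widen_inst u). Qed.

Lemma idle_ext_delay_step d c c' t : 0 <= t ->
  delay_step d c c' -> delay_step d (idle_ext c t) (idle_ext c' (t + d)).
Proof.
move=> t_ge0 [d_ge0 -> ok]; split=> [||d' /andP[d'_ge0 le_d'd]] //.
  by rewrite delay_idle_ext.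
rewrite delay_idle_ext; apply: idle_ext_config; first exact: addr_ge0.
by apply: ok; rewrite d'_ge0.
Qed.

Lemma restrict_delay_step d C C' :
  delay_step d C C' -> delay_step d (restrict C) (restrict C').
Proof.
by move=> [d_ge0 -> ok]; split=> // d' /ok; apply: restrict_config.
Qed.

Lemma idle_ext_discrete_step c c' t : conjunctive U -> 0 <= t ->
  discrete_step c c' -> discrete_step (idle_ext c t) (idle_ext c' t).
Proof.
move=> conjU t_ge0 [u [g [r [gam [tr g_ok gam_ok clk_u [frame c'_ok]]]]]].
exists (widen_inst u), g, r, gam; split.
- by rewrite !loc_idle_ext.
- by rewrite clk_idle_ext.
- move=> u'; case: (widen_instP u') => [[w ->]|[_ -> _] _].
    by rewrite (inj_eq widen_inst_inj) loc_idle_ext => /gam_ok.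
  exact: (conjU _ _ _ _ _ _ tr).
- by move=> x; rewrite !clk_idle_ext.
split; last exact: idle_ext_config.
move=> u'; case: (widen_instP u') => [[w ->]|[_ locE clkE] _].
  by rewrite (inj_eq widen_inst_inj) !loc_idle_ext !clk_idle_ext; apply: frame.
by rewrite !locE !clkE.
Qed.

(** A move of an old instance survives because its guard then ranges over fewer instances; a move of
    an additional instance is invisible to [restrict]. *)
Lemma restrict_discrete_step C C' : discrete_step C C' ->
  discrete_step (restrict C) (restrict C') \/ restrict C' = restrict C.
Proof.
move=> [u [g [r [gam [tr g_ok gam_ok clk_u [frame C'_ok]]]]]].
case: (widen_instP u) => [[w def_u]|[new_u _ _]].
  subst u; left; exists w, g, r, gam; split=> //.
    move=> w' ne_w'w; apply: (gam_ok (widen_inst w')).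
    by rewrite (inj_eq widen_inst_inj).
  split; last exact: restrict_config.
  by move=> w' ne_w'w; apply: (frame (widen_inst w')); rewrite (inj_eq widen_inst_inj).
right; rewrite /restrict; congr State;
  apply: functional_extensionality_dep => w; case: (frame _ (new_u w)) => //.
by move=> _ /funext.
Qed.

Lemma idle_ext_timed_step a b : conjunctive U -> 0 <= a.2 -> timed_step a b ->
  timed_step (idle_ext a.1 a.2, a.2) (idle_ext b.1 b.2, b.2).
Proof.
move=> conjU a_ge0 [[d d_gt0 [step ->]] | [step ->]].
  by left; exists d => //; split=> //; apply: idle_ext_delay_step.
by right; split=> //; apply: idle_ext_discrete_step.
Qed.

(** * Computations, s-paths and satisfaction *)

Lemma in_rangeW M (x : timed_seq R U M) v : in_range x v.+1 -> in_range x v.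
Proof. by rewrite /in_range; case: last_index => // k /ltnW. Qed.

Lemma time_ge0 M (x : timed_seq R U M) v :
  timed_computation x -> in_range x v -> 0 <= (entry x v).2.
Proof.
move=> [x0 stepx]; elim: v => [|v IHv] xv; first by rewrite x0.
have := IHv (in_rangeW xv).
by case: (stepx v xv) => [[d /ltW d_ge0 [_ ->]] | [_ ->]] // ?; apply: addr_ge0.
Qed.

(** Induction on [Phi] for all pairs of paths, since until passes to suffixes. The bound on [i]
    ensures that an atom true in the larger network speaks of an instance of the smaller one. *)
Lemma sat_restrict (rho : tpath R U N) (rho' : tpath R U N') l i Phi :
  only_instance l i Phi -> (i <= N l)%N ->
  (forall t c, rho t c <-> exists2 C, rho' t C & restrict C = c) ->
  sat rho Phi <-> sat rho' Phi.
Proof.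
move=> + le_iN; elim: Phi rho rho' =>
  [l' i' p|Phi1 IH1 Phi2 IH2|Phi1 IH1|Phi1 IH1 o q Phi2 IH2] rho rho' /=.
- move=> /andP[/eqP el /eqP ei] rhoE; subst l' i'.
  split=> [[c /rhoE[C rhoC <-] [j ji <-]] | [C rhoC [j ji <-]]].
    by exists C => //; exists (widen_ord (leN l) j).
  exists (restrict C); first by apply/rhoE; exists C.
  have lt_jN : (j < N l)%N by rewrite -ji in le_iN.
  exists (Ordinal lt_jN) => //=; rewrite /widen_inst /=.
  suff -> : widen_ord (leN l) (Ordinal lt_jN) = j by [].
  exact: val_inj.
- by move=> /andP[o1 o2] rhoE; rewrite (IH1 _ _ o1 rhoE) (IH2 _ _ o2 rhoE).
- by move=> o1 rhoE; rewrite (IH1 _ _ o1 rhoE).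
move=> /andP[o1 o2] rhoE.
have E1 t : sat (from_time rho t) Phi1 <-> sat (from_time rho' t) Phi1.
  by apply: IH1 => // t' c; apply: rhoE.
have E2 t : sat (from_time rho t) Phi2 <-> sat (from_time rho' t) Phi2.
  by apply: IH2 => // t' c; apply: rhoE.
split=> -[t [t_ge0 [c rhoc] tq /E2 sat2 sat1]]; exists t; split=> //.
- by have [C rhoC _] := (rhoE _ _).1 rhoc; exists C.
- by move=> t' /sat1/E1.
- by exists (restrict c); apply/rhoE; exists c.
- by move=> t' /sat1/E1.
Qed.

(** The sequence [y] may outlast [x], but only with time standing still: the surplus intervals are
    empty and add nothing to the s-path. *)
Lemma spath_restrict (x : timed_seq R U N) (y : timed_seq R U N') :
  (forall v, in_range x v -> in_range y v) ->
  (forall v, in_range x v -> entry x v = (restrict (entry y v).1, (entry y v).2)) ->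
  (forall v, in_range y v.+1 -> ~~ in_range x v.+1 ->
     (entry y v.+1).2 = (entry y v).2) ->
  forall t c, spath x t c <-> exists2 C, spath y t C & restrict C = c.
Proof.
move=> xy entryE tail t c; split=> [[v [xv]] | [C [v [yv]]]].
  rewrite (entryE _ xv) (entryE _ (in_rangeW xv)) /= => tv ->.
  by exists (delay (entry y v).1 (t - (entry y v).2)) => //; exists v; split=> //; apply: xy.
have [xv tv -> <-|xv] := boolP (in_range x v.+1).
  by exists v; rewrite (entryE _ xv) (entryE _ (in_rangeW xv)).
by rewrite tail // => /andP[le_t lt_t]; have := le_lt_trans le_t lt_t; rewrite ltxx.
Qed.

Definition idle_seq (x : timed_seq R U N) : timed_seq R U N' :=
  TimedSeq (last_index x)
    (fun v => (idle_ext (entry x v).1 (entry x v).2, (entry x v).2)).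

Lemma idle_seq_computation x :
  conjunctive U -> timed_computation x -> timed_computation (idle_seq x).
Proof.
move=> conjU comp_x; have [x0 stepx] := comp_x.
split=> [|v xv] /=; first by rewrite x0 idle_ext_init.
apply: idle_ext_timed_step => //; last exact: stepx.
by apply: time_ge0 => //; apply: in_rangeW.
Qed.

Lemma spath_idle_seq x t c :
  spath x t c <-> exists2 C, spath (idle_seq x) t C & restrict C = c.
Proof.
apply: spath_restrict => // [v _|v yv]; last by rewrite [in_range _ _]yv.
by rewrite /= restrict_idle_ext; case: entry.
Qed.

(** * Deadlocks and the continuation by additional instances *)

Lemma restrict_deadlock C C' :
  (forall c', ~ discrete_step (restrict C) c') ->
  discrete_step C C' -> restrict C' = restrict C.
Proof. by move=> stuck /restrict_discrete_step[/stuck|]. Qed.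

(** Iterate a successor function obtained by choice. If the iteration ever gets stuck, the least
    stuck index is [m], and by minimality every earlier state can move. *)
Lemma greedy_run (C : state R U N') : exists D : nat -> state R U N',
  D 0 = C /\
  ((forall m, discrete_step (D m) (D m.+1)) \/
   exists2 m, forall p, (p < m)%N -> discrete_step (D p) (D p.+1) &
     forall C', ~ discrete_step (D m) C').
Proof.
have [next nextP] : exists next : state R U N' -> state R U N',
    forall B B', discrete_step B B' -> discrete_step B (next B).
  exists (fun B => if pselect (exists B', discrete_step B B') is left ex
    then sval (cid ex) else B) => B B' stepB.
  by case: pselect => [ex|[]]; [case: (cid ex) | exists B'].
exists (fun m => iter m next C); split=> //.
pose stuck m := `[< forall C', ~ discrete_step (iter m next C) C' >].
have live m : ~~ stuck m -> discrete_step (iter m next C) (iter m.+1 next C).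
  by move=> /asboolPn/existsNP[C' /contrapT/nextP].
have [stk|nostk] := EM (exists m, stuck m); last first.
  by left=> m; apply: live; apply/negP => stkm; apply: nostk; exists m.
right; case: (ex_minnP stk) => m /asboolP stkm min_m.
exists m => // p lt_pm; apply: live; apply/negP => /min_m.
by rewrite leqNgt lt_pm.
Qed.

Lemma models_more_instances Q l i Phi : conjunctive U ->
  only_instance l i Phi -> (i <= N l)%N ->
  models R U N Q Phi -> models R U N' Q Phi.
Proof.
move=> conjU onlyPhi le_iN [x [comp_x Qx satx]].
have comp_idle := idle_seq_computation conjU comp_x.
have sat_idle : sat (spath (idle_seq x)) Phi.
  exact/(sat_restrict onlyPhi le_iN (spath_idle_seq x)).
have [Q_idle|Q_idle] := EM (quant_sem Q (idle_seq x)); first by exists (idle_seq x).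
(* [idle_seq] keeps [last_index], so only a deadlocked [x] under [QE] remains. *)
case: Q Qx Q_idle => //= -[? []|]; first by left.
move=> [k [last_x no_step no_dstep]] _.
have x_range v : in_range x v = (v <= k)%N by rewrite /in_range last_x.
pose T := (entry x k).2.
have [D [D0 runD]] := greedy_run (idle_ext (entry x k).1 T).
(* The idle computation is followed up to its last index [k], then the greedy run with time frozen
   at [T]. Both descriptions agree at [k], as [D 0] is the state reached there. *)
pose e v := if (v <= k)%N then entry (idle_seq x) v else (D (v - k)%N, T).
have eD p : e (k + p)%N = (D p, T).
  rewrite /e addKn; case: p => [|p]; last by rewrite addnS ltnNge leq_addr.
  by rewrite addn0 leqnn D0.
have comp_e last : (forall v, in_range (TimedSeq last e) v.+1 -> (k <= v)%N ->
    discrete_step (D (v - k)%N) (D (v.+1 - k)%N)) ->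
    timed_computation (TimedSeq last e).
  move=> stepD; split=> [|v ev] /=; first exact: comp_idle.1.
  have [le_kv|lt_vk] := leqP k v; last first.
    by rewrite /e lt_vk ltnW //; apply: comp_idle.2; rewrite [in_range _ _]x_range.
  have := stepD v ev le_kv; rewrite -(subnKC le_kv) -addnS !eD !addKn.
  by right.
have sat_e last : (forall v, (v <= k)%N -> in_range (TimedSeq last e) v) ->
    sat (spath (TimedSeq last e)) Phi.
  move=> le_e; apply: (sat_restrict onlyPhi le_iN _).1 satx.
  apply: spath_restrict => [v|v|v _]; rewrite x_range.
  - exact: le_e.
  - by move=> le_vk; rewrite /= /e le_vk /= restrict_idle_ext; case: entry.
  by rewrite -ltnNge ltnS /= => le_kv; rewrite -(subnKC le_kv) -addnS !eD.
(* An endless greedy run yields an infinite computation, which also witnesses [QE]; otherwise the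
   result must be shown deadlocked. *)
have [runs|[m runs stuck]] := runD.
  exists (TimedSeq None e); split=> //; [|by left|exact: sat_e].
  by apply: comp_e => v _ le_kv; rewrite subSn.
have restrD p : (p <= m)%N -> restrict (D p) = (entry x k).1.
  elim: p => [|p IHp] le_pm; first by rewrite D0 restrict_idle_ext.
  have Dp := IHp (ltnW le_pm).
  by rewrite -Dp; apply: restrict_deadlock (runs p le_pm); rewrite Dp.
exists (TimedSeq (Some (k + m)%N) e); split=> //.
- by apply: comp_e => v ltv le_kv; rewrite subSn //; apply: runs; rewrite ltn_subLR.
- right; exists (k + m)%N; rewrite /= eD; split=> // b [[d d_gt0 [dstep _]]|[st _]].
    (* By [restrD] the old instances are still in the last state of [x], so a delay here would
       restrict to a delay prolonging [x]. *)
    apply: (no_step (restrict b.1, T + d)); left; exists d => //; split=> //.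
    by have := restrict_delay_step dstep; rewrite restrD.
  exact: stuck st.
by apply: sat_e => v le_vk; apply: leq_trans le_vk (leq_addr _ _).
Qed.

End MoreInstances.

Theorem theorem3 (R : realType) (S : bool -> finType)
    (U1 : template S T1) (U2 : template S T2)
    (hU : conjunctive (templates U1 U2)) (Q : quant) (n : nat) (hn : (1 <= n)%N) :
  (forall Phi : imtl S, only_instance T2 1 Phi ->
     models R (templates U1 U2) (sizes 1 n) Q Phi ->
     models R (templates U1 U2) (sizes 1 n.+1) Q Phi) /\
  (forall Phi : imtl S, only_instance T1 1 Phi ->
     models R (templates U1 U2) (sizes 1 n) Q Phi ->
     models R (templates U1 U2) (sizes 1 n.+1) Q Phi).
Proof.
have le_sizes l : (sizes 1 n l <= sizes 1 n.+1 l)%N by case: l => /=.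
(* Instance 1 exists in the smaller network: for [T2] because [n] is positive, for [T1] because the
   size is 1. *)
by split=> Phi onlyPhi; apply: models_more_instances onlyPhi _.
Qed.
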